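(* For every sufficiently small $\varepsilon > 0$ there exists a constant $C$ such that the following holds. Let $G$ be a properly edge-colored graph on $n$ vertices such that $\delta(G) \ge (1 - \delta)n$ for some $\delta = \delta(n)$. Let $H$ be the spanning subgraph of $G$ obtained by choosing every color class independently at random with probability $p$. Then the following holds with high probability. (a) If $(1 - \delta)n \ge C \frac{\log n}{p}$, then every vertex $v$ satisfies $(1-\varepsilon)p\, d_G(v) \le d_H(v) \le (1+\varepsilon)p\, d_G(v)$. (b) For every pair $A$ and $B$ of disjoint vertex sets, if $|A| \ge C\frac{\log n}{p}$ and $|B| \ge \max\left\{C\left(\frac{\log n}{p}\right)^2, C \delta n\right\}$, then $e_H(A, B) \ge (1 - \varepsilon)p|A||B|$.
   Context: An edge-coloring of a graph is proper if, for each vertex, the edges incident to that vertex are given distinct colors. $\delta(G)$ denotes the minimum degree of $G$ (while $\delta$ alone is a real parameter, which may depend on $n$), and $d_G(v)$ is the degree of $v$ in $G$. A color class is the set of all edges of $G$ given a fixed color; $H$ has vertex set $V(G)$ and its edges are the union of the chosen color classes, where each color class is chosen independently with probability $p$; here $p\in(0,1]$ may depend on $n$. For disjoint vertex sets $A,B$, $e_H(A,B)$ is the number of edges $xy\in E(H)$ with $x\in A$ and $y\in B$. ''With high probability'' means with probability tending to $1$ as $n\to\infty$ (the constant $C$ depends only on $\varepsilon$). Logarithms are base $2$. *)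

(* Defs.v *)
From HB Require Import structures.
From mathcomp Require Import all_boot all_order all_algebra.
From mathcomp Require Import all_classical all_reals all_analysis.

Set Implicit Arguments.
Unset Strict Implicit.
Unset Printing Implicit Defensive.

Import Order.TTheory GRing.Theory Num.Theory.
Import numFieldNormedType.Exports.

Local Open Scope ring_scope.

Record sgraph (V : finType) := SGraph {
  adj : rel V;
  adj_sym : symmetric adj;
  adj_irr : irreflexive adj
}.

Section Graph.
Variable V : finType.
Implicit Types (G : sgraph V) (A B : {set V}).

Definition deg G (v : V) : nat := #|[set u | adj G v u]|.

(* The default value #|V| is never smaller than a degree, so it only matters
   for the graph without vertices, whose minimum degree is set to 0. *)
Definition mindeg G : nat := \big[minn/#|V|]_(v : V) deg G v.

(* Counted as ordered pairs; for disjoint A and B each edge between them is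
   counted exactly once. *)
Definition edges_between G A B : nat :=
  #|[set e : V * V | [&& e.1 \in A, e.2 \in B & adj G e.1 e.2]]|.

(* An edge xy is the unordered pair [set x; y]; the values of a coloring
   c : {set V} -> K outside the edges of G are never used. *)
Definition proper_coloring (K : eqType) G (c : {set V} -> K) : Prop :=
  forall v x y : V, adj G v x -> adj G v y -> x != y ->
    c [set v; x] != c [set v; y].

Section ColorSubgraph.
Variables (K : finType) (G : sgraph V) (c : {set V} -> K) (S : {set K}).

Definition color_adj : rel V :=
  fun x y => adj G x y && (c [set x; y] \in S).

Lemma color_adj_sym : symmetric color_adj.
Proof. by move=> x y; rewrite /color_adj adj_sym finset.setUC. Qed.

Lemma color_adj_irr : irreflexive color_adj.
Proof. by move=> x; rewrite /color_adj adj_irr. Qed.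

Definition color_subgraph : sgraph V := SGraph color_adj_sym color_adj_irr.

End ColorSubgraph.
End Graph.

(* Probability of the event E for the random set S of colors containing each
   color independently with probability p. *)
Definition random_colors_prob (R : realType) (K : finType) (p : R)
    (E : {set K} -> Prop) : R :=
  \sum_(S : {set K} | `[< E S >])
    \prod_(k : K) (if k \in S then p else 1 - p).

Definition log2 (R : realType) (x : R) : R := ln x / ln 2.

(* Main.v *)
(* Since the coloring is proper, the colors at a vertex are distinct, so (a) is
   a Chernoff bound at each vertex. For (b), a union bound over all pairs (A, B)
   is too expensive, because a color may carry up to min(|A|, |B|) edges between
   A and B. Instead take a of order (log n)/p and consider pairs (X, T) of
   a-sets that span at least (1 - eta) a^2 distinct colors: Chernoff gives
   failure probability n^(-3a) for each, against at most n^(2a) pairs. As long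
   as d and a^2 are at most eta |B'|, where n - d bounds the degrees from below,
   a greedy choice of vertices in B' yields such a T for any given X: the at
   most a^2 colors already used kill at most a^2 neighbors of each x in X. So
   almost all of B can be cut into such sets T, and almost all of A into
   a-sets X. *)

Require Import Defs.
From HB Require Import structures.
From mathcomp Require Import all_boot all_order all_algebra.
From mathcomp Require Import all_classical all_reals all_analysis.
From mathcomp Require Import fintype finset ring lra.

Set Implicit Arguments.
Unset Strict Implicit.
Unset Printing Implicit Defensive.

Import Order.TTheory GRing.Theory Num.Theory.
Import numFieldNormedType.Exports.

Local Open Scope ring_scope.

(** * Tail bounds for the number of chosen colors in a fixed set *)

Section RandomColors.
Variables (R : realType) (K : finType) (p : R).
Hypotheses (p_ge0 : 0 <= p) (p_le1 : p <= 1).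
Implicit Types (E F : {set K} -> Prop) (S D : {set K}).

Local Notation w S := (\prod_(k : K) (if k \in S then p else 1 - p)).
Local Notation Pr := (random_colors_prob p).

Lemma color_weight_ge0 S : 0 <= w S.
Proof. by apply: prodr_ge0 => k _; case: ifP => _ //; rewrite subr_ge0. Qed.

Lemma color_weight_sum : \sum_(S : {set K}) w S = 1.
Proof.
by rewrite -bigA_distr /= big1 // => k _; rewrite addrC subrK.
Qed.

Lemma random_colors_probC E : Pr E = 1 - Pr (fun S => ~ E S).
Proof.
apply/eqP; rewrite eq_sym subr_eq; apply/eqP; rewrite -color_weight_sum.
rewrite (bigID (fun S => `[< E S >])) /=; congr (_ + _).
by apply: eq_bigl => S; rewrite asbool_neg.
Qed.

(** Markov's inequality in the form behind both later estimates: [X] is a sum of indicators for the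
    union bound and an exponential for Chernoff. *)
Lemma random_colors_prob_le E (X : {set K} -> R) :
  (forall S, 0 <= X S) -> (forall S, E S -> 1 <= X S) ->
  Pr E <= \sum_(S : {set K}) w S * X S.
Proof.
move=> X_ge0 X_ge1; rewrite /random_colors_prob [leRHS](bigID (fun S => `[< E S >])) /=.
apply: ler_wpDr; first by apply: sumr_ge0 => S _; rewrite mulr_ge0 ?color_weight_ge0.
by apply: ler_sum => S /asboolP /X_ge1 h; rewrite ler_peMr ?color_weight_ge0.
Qed.

Lemma random_colors_prob_ge0 E : 0 <= Pr E.
Proof. by apply: sumr_ge0 => S _; apply: color_weight_ge0. Qed.

Lemma random_colors_prob_le1 E : Pr E <= 1.
Proof. by rewrite random_colors_probC gerBl random_colors_prob_ge0. Qed.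

Lemma sub_random_colors_prob E F : (forall S, E S -> F S) -> Pr E <= Pr F.
Proof.
move=> EF; rewrite /random_colors_prob (big_mkcond (fun S => `[< F S >])) /=.
apply: le_trans (_ : _ <= \sum_(S | `[< E S >]) if `[< F S >] then w S else 0) _.
  by apply: ler_sum => S /asboolP /EF /asboolP ->.
rewrite [leRHS](bigID (fun S => `[< E S >])) /= lerDl; apply: sumr_ge0 => S _.
by case: ifP => // _; apply: color_weight_ge0.
Qed.

Lemma random_colors_prob_union (I : finType) (P : pred I) (E : I -> {set K} -> Prop) :
  Pr (fun S => exists2 i, P i & E i S) <= \sum_(i | P i) Pr (E i).
Proof.
apply: le_trans (random_colors_prob_le
  (X := fun S => \sum_(i | P i) (`[< E i S >]%:R)) _ _) _.
- by move=> S; apply: sumr_ge0.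
- move=> S [i Pi /asboolP Ei]; rewrite (bigD1 i) //= Ei lerDl.
  exact: sumr_ge0.
under eq_bigr do rewrite mulr_sumr.
rewrite exchange_big /=; apply: ler_sum => i _.
rewrite /random_colors_prob [leRHS]big_mkcond /=; apply: ler_sum => S _.
by case: ifP => _; rewrite ?mulr1 ?mulr0.
Qed.

Lemma random_colors_probU E F :
  Pr (fun S => E S \/ F S) <= Pr E + Pr F.
Proof.
have := @random_colors_prob_union bool predT (fun b => if b then E else F).
rewrite big_bool /=; apply: le_trans; apply: sub_random_colors_prob => S.
by case=> h; [exists true | exists false].
Qed.

(** Independence splits the expectation into one factor per color; a color outside [D] contributes
    [p + (1 - p) = 1]. *)
Lemma random_colors_mgf D (t : R) :
  \sum_(S : {set K}) w S * expR (t * #|S :&: D|%:R) =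
  (1 + p * (expR t - 1)) ^+ #|D|.
Proof.
transitivity (\sum_(S : {set K}) \prod_(k : K)
    (if k \in S then (if k \in D then p * expR t else p) else 1 - p)).
  apply: eq_bigr => S _.
  rewrite [t * _]mulrC expRM_natl -prodr_const [X in _ * X]big_mkcond -big_split /=.
  by apply: eq_bigr => k _; rewrite inE; case: (k \in S); case: (k \in D); rewrite /= ?mulr1.
rewrite -bigA_distr /= -prodr_const [RHS]big_mkcond /=.
by apply: eq_bigr => k _; case: ifP => _; ring.
Qed.

(** From [1 - t <= expR (- t)] comes [expR t <= (1 - t)^-1], and [(1 - t) * (1 + t + 2 * t ^+ 2) = 1
    + t ^+ 2 * (1 - 2 * t)] is at least 1. Negative [t] is covered too, as the lower tail
    requires. *)
Lemma expR_le_quadratic (t : R) : t <= 1/2 -> expR t <= 1 + t + 2 * t ^+ 2.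
Proof.
move=> t_le; have /= h := expR_ge1Dx (- t).
have t1 : 0 < 1 - t by lra.
have : expR t <= (1 - t)^-1.
  by rewrite -[expR t]invrK -expRN lef_pV2 // posrE ?expR_gt0.
move/le_trans; apply; rewrite -div1r ler_pdivrMr //; nra.
Qed.

(** Keeping the factor [t] on both sides of the event treats both tails at once: a negative [t]
    turns it into a lower tail. *)
Lemma random_colors_chernoff D (t r : R) : t <= 1/2 ->
  Pr (fun S => t * r <= t * #|S :&: D|%:R) <=
  expR (p * (t + 2 * t ^+ 2) * #|D|%:R - t * r).
Proof.
move=> t_le.
apply: le_trans (random_colors_prob_le
  (X := fun S => expR (t * #|S :&: D|%:R) * expR (- (t * r))) _ _) _.
- by move=> S; rewrite mulr_ge0 ?expR_ge0.
- by move=> S h; rewrite -expRD -[leLHS]expR0 ler_expR subr_ge0.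
under eq_bigr do rewrite mulrA.
rewrite -mulr_suml random_colors_mgf expRD ler_pM2r ?expR_gt0 //.
rewrite [_ * #|D|%:R]mulrC expRM_natl; apply: lerXn2r; rewrite ?nnegrE ?expR_ge0 //.
  have h1 : 0 <= 1 - p by rewrite subr_ge0.
  have h := mulr_ge0 p_ge0 (expR_ge0 t).
  suff -> : 1 + p * (expR t - 1) = 1 - p + p * expR t by apply: addr_ge0.
  by ring.
apply: le_trans (expR_ge1Dx _); rewrite lerD2l ler_wpM2l //.
by have := expR_le_quadratic t_le; lra.
Qed.

Lemma random_colors_lower_tail D (e : R) : 0 <= e ->
  Pr (fun S => #|S :&: D|%:R <= (1 - e) * p * #|D|%:R) <=
  expR (- (e ^+ 2 / 8 * (p * #|D|%:R))).
Proof.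
(* Up to the factor [p * #|D|] the exponent is [t * e + 2 * t ^+ 2], which is minimal at
   [t = - e / 4] with value [- e ^+ 2 / 8]. *)
move=> e0; have h : - e / 4 <= 1 / 2 by lra.
have := @random_colors_chernoff D (- e / 4) ((1 - e) * p * #|D|%:R) h.
rewrite [X in _ <= expR X -> _](_ : _ = - (e ^+ 2 / 8 * (p * #|D|%:R))); last by field.
apply: le_trans; apply: sub_random_colors_prob => S /= hS; nra.
Qed.

Lemma random_colors_upper_tail D (e : R) : 0 <= e -> e <= 1 ->
  Pr (fun S => (1 + e) * p * #|D|%:R <= #|S :&: D|%:R) <=
  expR (- (e ^+ 2 / 8 * (p * #|D|%:R))).
Proof.
move=> e0 e1; have h : e / 4 <= 1 / 2 by lra.
have := @random_colors_chernoff D (e / 4) ((1 + e) * p * #|D|%:R) h.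
rewrite [X in _ <= expR X -> _](_ : _ = - (e ^+ 2 / 8 * (p * #|D|%:R))); last by field.
apply: le_trans; apply: sub_random_colors_prob => S /= hS; nra.
Qed.

End RandomColors.

(** Blocks [T] of size [a] are cut off while at least [m] elements remain, and superadditivity
    collects [q] per removed element. Once fewer than [m] remain, the claimed bound is
    nonpositive. *)
Lemma peel (R : realDomainType) (V : finType) (f : {set V} -> R)
    (B : {set V}) (a : nat) (m q : R) :
  (0 < a)%N -> 0 <= q -> (forall X, 0 <= f X) ->
  (forall X Y : {set V}, [disjoint X & Y] -> f X + f Y <= f (X :|: Y)) ->
  (forall X : {set V}, X \subset B -> m <= #|X|%:R ->
     exists2 T : {set V}, T \subset X & #|T| = a /\ a%:R * q <= f T) ->
  (#|B|%:R - m) * q <= f B.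
Proof.
move=> a_gt0 q_ge0 f_ge0 f_add block.
suff peelX k (X : {set V}) : (#|X| <= k)%N -> X \subset B ->
    (#|X|%:R - m) * q <= f X.
  exact: (peelX _ _ (leqnn _)).
elim: k X => [|k IHk] X X_le XB.
  have [m_le|m_gt] := leP m #|X|%:R; last first.
    by apply: le_trans (f_ge0 X); nra.
  have [T TX [cT _]] := block X XB m_le.
  by have := subset_leq_card TX; rewrite cT => a_le; move: (leq_trans a_gt0 (leq_trans a_le X_le)).
have [m_le|m_gt] := leP m #|X|%:R; last first.
  by apply: le_trans (f_ge0 X); nra.
have [T TX [cT fT]] := block X XB m_le.
have cXT : #|X| = (a + #|X :\: T|)%N by rewrite -cT -(cardsID T X) (setIidPr TX).
have XTB : X :\: T \subset B by apply: fintype.subset_trans XB; apply: subsetDl.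
have XT_le : (#|X :\: T| <= k)%N.
  by rewrite -ltnS; apply: leq_trans X_le; rewrite cXT -[X in (X < _)%N]add0n ltn_add2r.
have dis : [disjoint T & X :\: T].
  by rewrite -setI_eq0 setIDA setDIl setDv set0I.
have := f_add T (X :\: T) dis.
have -> : T :|: X :\: T = X.
  by apply/setP => x; rewrite !inE; case: (boolP (x \in T)) => // /(subsetP TX).
apply: le_trans; have := IHk _ XT_le XTB; rewrite cXT natrD; nra.
Qed.

(** * Superadditivity of edge counts in each side *)

Section EdgesBetween.
Variables (V : finType) (G : sgraph V).
Implicit Types A B X Y : {set V}.

Lemma edges_betweenUl X Y B : [disjoint X & Y] ->
  (edges_between G X B + edges_between G Y B <= edges_between G (X :|: Y) B)%N.
Proof.
move=> /pred0P dXY; rewrite /edges_between -cardsUI.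
rewrite [X in (_ + X)%N](_ : _ = 0)%N ?addn0.
  by apply: subset_leq_card; apply/subsetP => e; rewrite !inE;
     case/orP => /and3P [-> -> ->]; rewrite ?orbT.
apply/eqP; rewrite cards_eq0; apply/eqP/setP => e; rewrite !inE.
by have /= := dXY e.1; do 2 case: (_ \in _) => //=; rewrite ?andbF.
Qed.

Lemma edges_betweenUr A X Y : [disjoint X & Y] ->
  (edges_between G A X + edges_between G A Y <= edges_between G A (X :|: Y))%N.
Proof.
move=> /pred0P dXY; rewrite /edges_between -cardsUI.
rewrite [X in (_ + X)%N](_ : _ = 0)%N ?addn0.
  by apply: subset_leq_card; apply/subsetP => e; rewrite !inE;
     case/orP => /and3P [-> -> ->]; rewrite ?orbT.
apply/eqP; rewrite cards_eq0; apply/eqP/setP => e; rewrite !inE.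
by have /= := dXY e.2; do 2 case: (_ \in _) => //=; rewrite ?andbF.
Qed.

End EdgesBetween.

(** * Distinct colors at a vertex and between two sets *)

Section Colors.
Variables (V K : finType) (G : sgraph V) (c : {set V} -> K).
Hypothesis c_proper : proper_coloring G c.
Implicit Types (A B T : {set V}) (S : {set K}).

Definition star_colors A (v : V) : {set K} :=
  [set c [set v; x] | x in A & adj G v x].

Definition colors_between A T : {set K} := \bigcup_(v in T) star_colors A v.

Lemma star_color_inj v : {in adj G v &, injective (fun x => c [set v; x])}.
Proof.
move=> x y vx vy exy; apply/eqP/negP => /negP xy.
by have := c_proper vx vy xy; rewrite exy eqxx.
Qed.

(** Properness makes neighbors and colors at [v] correspond one to one. The predicate [P] lets one
    count serve degrees in the whole graph, degrees in the random subgraph, and colors outside a set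
    [U]. *)
Lemma card_star_colorsI (P : pred K) A v :
  #|[set k in star_colors A v | P k]| =
  #|[set x in A | adj G v x && P (c [set v; x])]|.
Proof.
rewrite -(card_in_imset (f := fun x => c [set v; x])
  (D := [set x in A | adj G v x && P (c [set v; x])])); last first.
  move=> x y; rewrite !inE => /and3P[_ vx _] /and3P[_ vy _].
  exact: star_color_inj.
apply: eq_card => k; rewrite !inE; apply/andP/imsetP.
  case=> /imsetP[x]; rewrite !inE => /andP[xA vx] -> Pk.
  by exists x => //; rewrite !inE xA vx.
case=> x; rewrite !inE => /and3P[xA vx Px] ->; split=> //.
by apply: imset_f; rewrite !inE xA.
Qed.

Lemma card_star_colors v : #|star_colors [set: V] v| = deg G v.
Proof.
have := card_star_colorsI predT [set: V] v; rewrite /deg => h.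
rewrite -(eq_card (A := [set k in star_colors [set: V] v | predT k])).
  by rewrite h; apply: eq_card => x; rewrite !inE andbT.
by move=> k; rewrite inE andbT.
Qed.

Lemma deg_color_subgraph S v :
  deg (color_subgraph G c S) v = #|S :&: star_colors [set: V] v|.
Proof.
have := card_star_colorsI (fun k => k \in S) [set: V] v; rewrite /deg => h.
transitivity #|[set k in star_colors [set: V] v | k \in S]|.
  by rewrite h; apply: eq_card => x; rewrite !inE.
by apply: eq_card => k; rewrite !inE andbC.
Qed.

(** One edge is kept per chosen color, so the edge count is bounded below by a sum of independent
    indicators. *)
Lemma card_colors_between_subgraph S A T :
  (#|S :&: colors_between A T| <= edges_between (color_subgraph G c S) A T)%N.
Proof.
rewrite /edges_between; set E := [set _ | _].
suff /subset_leq_card/leq_trans : S :&: colors_between A T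
    \subset [set c [set e.1; e.2] | e in E] by apply; apply: leq_imset_card.
apply/subsetP => k; rewrite inE => /andP[kS /bigcupP[v vT]].
case/imsetP => x; rewrite inE => /andP[xA vx] def_k.
apply/imsetP; exists (x, v); last by rewrite def_k setUC.
rewrite !inE /= xA vT /color_adj adj_sym vx /=.
by rewrite setUC -def_k.
Qed.

Lemma card_colors_between_le A T : (#|colors_between A T| <= #|T| * #|A|)%N.
Proof.
rewrite /colors_between.
apply: leq_trans (_ : _ <= \sum_(v in T) #|A|)%N _; last by rewrite sum_nat_const.
elim/big_ind2: _ => [|X m Y n hX hY|v _]; first by rewrite cards0.
  by apply: leq_trans (leq_add hX hY); apply: leq_card_setU.
apply: leq_trans (leq_imset_card _ _) _.
by apply: subset_leq_card; apply/subsetP => x; rewrite inE => /andP[].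
Qed.

(* Each color of U appears on at most one edge at x, so x loses at most
   [#|U|] of its neighbors in B. *)
Lemma new_color_nbrs (U : {set K}) B x :
  (#|B| + deg G x <= #|[set v in B | adj G v x && (c [set v; x] \notin U)]|
     + #|U| + #|V|)%N.
Proof.
set N := [set v in B | _].
pose O := [set v | adj G x v & c [set x; v] \in U].
have cO : (#|O| <= #|U|)%N.
  rewrite -(card_in_imset (f := fun v => c [set x; v]) (D := O)).
    apply: subset_leq_card; apply/subsetP => k /imsetP[v].
    by rewrite inE => /andP[_ vU] ->.
  move=> u v; rewrite !inE => /andP[xu _] /andP[xv _]; exact: star_color_inj.
rewrite /deg; set Nx := [set u | adj G x u].
have cI : (#|B :&: Nx| <= #|N| + #|U|)%N.
  apply: leq_trans (leq_add (leqnn _) cO); rewrite -cardsUI.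
  apply: leq_trans (leq_addr _ _); apply: subset_leq_card; apply/subsetP => v.
  rewrite !inE => /andP[vB xv]; rewrite vB xv adj_sym xv /= setUC.
  by rewrite orNb.
rewrite -cardsUI addnC leq_add //; exact: max_card.
Qed.

(** Double counting of the edges between [A] and [B] with color outside [U]; seen from [v] in [B],
    such edges have distinct colors. *)
Lemma sum_new_colors (U : {set K}) A B :
  (\sum_(v in B) #|star_colors A v :\: U| =
   \sum_(x in A) #|[set v in B | adj G v x && (c [set v; x] \notin U)]|)%N.
Proof.
transitivity (\sum_(v in B) \sum_(x in A)
    (adj G v x && (c [set v; x] \notin U)))%N.
  apply: eq_bigr => v _.
  transitivity #|[set k in star_colors A v | k \notin U]|.
    by apply: eq_card => k; rewrite !inE andbC.
  rewrite (card_star_colorsI (fun k => k \notin U)) -sum1_card.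
  rewrite big_mkcond [RHS]big_mkcond /=; apply: eq_bigr => x _.
  by rewrite !inE; case: (x \in A) => //=; case: (_ && _).
rewrite exchange_big /=; apply: eq_bigr => x _.
rewrite -sum1_card big_mkcond [RHS]big_mkcond /=; apply: eq_bigr => v _.
by rewrite !inE; case: (v \in B) => //=; case: (_ && _).
Qed.

Lemma greedy_many_colors (R : realFieldType) (eta d : R) A B (a k : nat) :
  0 < eta -> 0 <= d -> (forall v, #|V|%:R - d <= (deg G v)%:R) ->
  #|A| = a -> (0 < a)%N -> (k <= a)%N ->
  a%:R + (d + a%:R ^+ 2) / eta <= #|B|%:R ->
  exists2 T : {set V}, T \subset B &
    #|T| = k /\ (1 - eta) * a%:R * k%:R <= #|colors_between A T|%:R.
Proof.
move=> eta_gt0 d_ge0 degG cA a_gt0 + B_ge; elim: k => [|k IHk] k_le.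
  by exists set0; rewrite ?sub0set // cards0 mulr0.
have [T TB [cT colT]] := IHk (ltnW k_le).
set U := colors_between A T in colT *.
have U_le : #|U|%:R <= a%:R ^+ 2 :> R.
  rewrite -natrX ler_nat; apply: leq_trans (card_colors_between_le A T) _.
  by rewrite cT cA -mulnn leq_mul2r (ltnW k_le) orbT.
have cB' : #|B| = (k + #|B :\: T|)%N by rewrite -cT -(cardsID T B) (setIidPr TB).
set B' := B :\: T in cB' *.
have B'_ge : (d + a%:R ^+ 2) <= eta * #|B'|%:R.
  rewrite mulrC -ler_pdivrMr //; move: B_ge; rewrite cB' natrD.
  have : k%:R <= a%:R :> R by rewrite ler_nat ltnW.
  lra.
have a1 : 1 <= a%:R :> R by rewrite ler1n.
(* Each [x] in [A] misses at most [d] vertices of [B'] and loses at most [a ^+ 2] more to the colors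
   in [U]. *)
have avg : (1 - eta) * a%:R * #|B'|%:R <=
    \sum_(v in B') (#|star_colors A v :\: U|%:R : R).
  rewrite -natr_sum sum_new_colors natr_sum.
  apply: le_trans (_ : _ <= \sum_(x in A) (#|B'|%:R - d - a%:R ^+ 2)) _.
    rewrite sumr_const cA -[leRHS]mulr_natl; nra.
  apply: ler_sum => x _; have := new_color_nbrs U B' x.
  rewrite -(ler_nat R) !natrD; have := degG x; lra.
have [v vB' v_ge] : exists2 v, v \in B' &
    (1 - eta) * a%:R <= #|star_colors A v :\: U|%:R.
  apply: contrapT => none; move: avg; apply/negP; rewrite -ltNge.
  have -> : (1 - eta) * a%:R * #|B'|%:R = \sum_(v in B') ((1 - eta) * a%:R).
    by rewrite sumr_const mulr_natr.
  (* Strict comparison of the sums needs a nonempty [B']; an empty one would force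
     [d + a ^+ 2 <= 0]. *)
  have [w wB'] : exists w, w \in B'.
    apply/set0Pn; rewrite -cards_eq0; apply/negP => /eqP c0.
    move: B'_ge; rewrite c0; nra.
  apply: ltr_sum => [|v vB']; last first.
    by rewrite ltNge; apply/negP => h; apply: none; exists v.
  by apply/hasP; exists w; rewrite // mem_index_enum.
move: vB'; rewrite inE => /andP[vT vB].
exists (v |: T); first by rewrite subUset sub1set vB.
split; first by rewrite cardsU1 vT cT.
rewrite /colors_between big_setU1 //= -/(colors_between A T) -/U.
have -> : #|star_colors A v :|: U| = (#|U| + #|star_colors A v :\: U|)%N.
  rewrite -(cardsID U (_ :|: _)) setIUl setIid.
  rewrite (setUidPr (subsetIr _ _)).
  by rewrite setDUl setDv setU0.
rewrite natrD -natr1; nra.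
Qed.

End Colors.

Lemma mindeg_le (V : finType) (G : sgraph V) v : (mindeg G <= deg G v)%N.
Proof.
rewrite /mindeg; elim: index_enum (mem_index_enum v) => //= u s IHs.
rewrite big_cons inE geq_min => /predU1P[<-|/IHs ->]; by rewrite ?leqnn ?orbT.
Qed.

Lemma leq_bin_exp n k : ('C(n, k) <= n ^ k)%N.
Proof.
apply: (@leq_trans (n ^_ k)).
  by rewrite -bin_ffact leq_pmulr ?fact_gt0.
elim: k n => [|k IHk] n //; rewrite ffactnS expnS leq_mul2l.
apply/orP; right; apply: leq_trans (IHk _) _.
by case: k {IHk} => // k; rewrite leq_exp2r // leq_pred.
Qed.

(** * Failure probabilities, and the edge bound when no rich pair fails *)

Section RandomSubgraph.
Variables (R : realType) (V K : finType) (G : sgraph V) (c : {set V} -> K).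
Hypothesis c_proper : proper_coloring G c.
Variable p : R.
Hypotheses (p_ge0 : 0 <= p) (p_le1 : p <= 1).

Local Notation N := (#|V|%:R : R).
Local Notation Pr := (random_colors_prob p).

Lemma degree_deviation_prob (e : R) :
  0 < e -> e <= 1 -> 0 < N ->
  (forall v, 16 / e ^+ 2 * ln N <= p * (deg G v)%:R) ->
  Pr (fun S => exists2 v, v \in V &
    (deg (color_subgraph G c S) v)%:R <= (1 - e) * p * (deg G v)%:R \/
    (1 + e) * p * (deg G v)%:R <= (deg (color_subgraph G c S) v)%:R)
  <= 2 / N.
Proof.
move=> e_gt0 e_le1 N_gt0 degG.
apply: le_trans (random_colors_prob_union p_ge0 p_le1 _ _) _.
apply: le_trans (_ : _ <= \sum_(v in V) (2 * (N ^- 2))) _; last first.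
  rewrite sumr_const -[leLHS]mulr_natl (_ : _ * _ = 2 / N) //.
  by field; rewrite gt_eqF.
apply: ler_sum => v _.
apply: le_trans (random_colors_probU p_ge0 p_le1 _ _) _.
(* The constant 16 makes the Chernoff exponent at least [2 * ln N]; two tails at each of [N]
   vertices then total [2 / N]. *)
have tail : expR (- (e ^+ 2 / 8 * (p * (deg G v)%:R))) <= N ^- 2.
  rewrite -[leRHS]lnK ?posrE ?invr_gt0 ?exprn_gt0 // ler_expR.
  rewrite lnV ?posrE ?exprn_gt0 // lnXn // lerN2 mulr2n.
  have := degG v; rewrite mulrAC ler_pdivrMr ?exprn_gt0 //; lra.
have low := random_colors_lower_tail p_ge0 p_le1 (star_colors G c [set: V] v) (ltW e_gt0).
have upp := random_colors_upper_tail p_ge0 p_le1 (star_colors G c [set: V] v) (ltW e_gt0) e_le1.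
rewrite card_star_colors // in low upp.
rewrite mulr_natl mulr2n; apply: lerD.
  apply: le_trans tail; apply: le_trans low; apply: sub_random_colors_prob => // S.
  by rewrite deg_color_subgraph.
apply: le_trans tail; apply: le_trans upp; apply: sub_random_colors_prob => // S.
by rewrite deg_color_subgraph.
Qed.

(** Richness is a property of the coloring alone, not of the random set, so a union bound over rich
    pairs makes sense. *)
Definition color_rich (eta : R) (a : nat) : pred ({set V} * {set V}) :=
  fun X => [&& #|X.1| == a, #|X.2| == a &
    (1 - eta) * a%:R ^+ 2 <= #|colors_between G c X.1 X.2|%:R].

Lemma color_rich_prob (eta : R) (a : nat) :
  0 < eta -> eta <= 1 / 2 -> 1 <= N -> (0 < a)%N ->
  48 / eta ^+ 2 * ln N <= p * a%:R ->
  Pr (fun S => exists2 X, color_rich eta a X &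
    #|S :&: colors_between G c X.1 X.2|%:R <=
      (1 - eta) * p * #|colors_between G c X.1 X.2|%:R)
  <= N^-1.
Proof.
move=> eta_gt0 eta_le N_ge1 a_gt0 pa_ge.
have N_gt0 : 0 < N by apply: lt_le_trans N_ge1.
apply: le_trans (random_colors_prob_union p_ge0 p_le1 _ _) _.
apply: le_trans (_ : _ <= \sum_(X | color_rich eta a X) (N ^- (3 * a))) _.
  apply: ler_sum => X /and3P[_ _ rich].
  apply: le_trans (random_colors_lower_tail p_ge0 p_le1 _ (ltW eta_gt0)) _.
  rewrite -[leRHS]lnK ?posrE ?invr_gt0 ?exprn_gt0 // ler_expR.
  rewrite lnV ?posrE ?exprn_gt0 // lnXn // lerN2 -[_ *+ (3 * a)]mulr_natl natrM.
  have a0 : 0 < a%:R :> R by rewrite ltr0n.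
  move: pa_ge; rewrite mulrAC ler_pdivrMr ?exprn_gt0 // => pa_ge.
  set x := #|_|%:R in rich *.
  (* As [eta <= 1 / 2], a rich pair has at least [a ^+ 2 / 2] colors. The exponent is then at least
     [eta ^+ 2 * p * a ^+ 2 / 16], and the constant 48 raises this to [3 * a * ln N]. *)
  have x_ge : a%:R ^+ 2 <= 2 * x by have := sqr_ge0 (a%:R : R); nra.
  have h1 : 0 <= (p * eta ^+ 2) * (2 * x - a%:R ^+ 2).
    by apply: mulr_ge0; [apply: mulr_ge0 => //; apply: sqr_ge0 | rewrite subr_ge0].
  have h2 : 0 <= a%:R * (p * a%:R * eta ^+ 2 - 48 * ln N).
    by apply: mulr_ge0; [apply: ltW | rewrite subr_ge0; lra].
  lra.
rewrite sumr_const -[leLHS]mulr_natl.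
have card_rich : (#|color_rich eta a| <= (#|V| ^ a) * (#|V| ^ a))%N.
  apply: leq_trans (leq_mul (leq_bin_exp _ _) (leq_bin_exp _ _)).
  rewrite -card_draws -cardsX; apply: subset_leq_card; apply/subsetP => X.
  by rewrite !inE => /and3P[-> ->].
apply: le_trans (_ : (N ^+ a * N ^+ a) * N ^- (3 * a) <= _).
  apply: ler_wpM2r; first by rewrite invr_ge0 exprn_ge0.
  by move: card_rich; rewrite -(ler_nat R) natrM natrX.
rewrite -exprD -(_ : (a + a + a)%N = (3 * a)%N); last by rewrite !mulSn mul0n addn0 addnA.
rewrite [N ^+ (a + a + a)]exprD invfM mulrA divff ?expf_neq0 ?gt_eqF // mul1r.
by rewrite lef_pV2 ?posrE ?exprn_gt0 // ler_eXnr.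
Qed.

(** Deterministic: four factors [1 - eta] are lost, to the random choice, to repeated colors, to the
    leftover of [B] and to the leftover of [A]. *)
Lemma edges_between_color_subgraph_ge (S : {set K}) (eta d : R) (a : nat)
    (A B : {set V}) :
  0 < eta -> eta <= 1 -> 0 <= d ->
  (forall v, N - d <= (deg G v)%:R) -> (0 < a)%N ->
  (forall X, color_rich eta a X ->
    (1 - eta) * p * #|colors_between G c X.1 X.2|%:R <=
      #|S :&: colors_between G c X.1 X.2|%:R) ->
  a%:R <= eta * #|A|%:R ->
  a%:R + (d + a%:R ^+ 2) / eta <= eta * #|B|%:R ->
  (1 - 4 * eta) * p * #|A|%:R * #|B|%:R <=
    (edges_between (color_subgraph G c S) A B)%:R.
Proof.
move=> eta_gt0 eta_le1 d_ge0 degG a_gt0 good A_ge B_ge.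
set H := color_subgraph G c S.
pose r := 1 - eta; have r_ge0 : 0 <= r by rewrite subr_ge0.
have a0 : 0 < a%:R :> R by rewrite ltr0n.
(* With [T] fixed on the left, [B] is peeled into greedy partners of [T]; this accounts for three of
   the four factors. *)
have slab (T : {set V}) : #|T| = a ->
    a%:R * (r ^+ 3 * p * #|B|%:R) <= (edges_between H T B)%:R.
  move=> cT.
  apply: le_trans (_ : (#|B|%:R - (a%:R + (d + a%:R ^+ 2) / eta)) *
      (r ^+ 2 * p * a%:R) <= _).
    have h : r * #|B|%:R <= #|B|%:R - (a%:R + (d + a%:R ^+ 2) / eta).
      by rewrite /r; lra.
    have h1 : 0 <= r ^+ 2 * p * a%:R by rewrite !mulr_ge0 // ltW.
    have := ler_wpM2r h1 h; lra.
  apply: (peel (f := fun X => (edges_between H T X)%:R) a_gt0).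
  - by rewrite !mulr_ge0 // ltW.
  - by [].
  - by move=> X Y dXY; rewrite -natrD ler_nat edges_betweenUr.
  move=> X XB X_ge.
  have [T' T'X [cT' col]] := greedy_many_colors c_proper eta_gt0 d_ge0 degG cT
    a_gt0 (leqnn a) X_ge.
  exists T' => //; split => //.
  have rich : color_rich eta a (T, T').
    by rewrite /color_rich /= cT cT' !eqxx /= expr2 mulrA.
  apply: le_trans (_ : #|S :&: colors_between G c T T'|%:R <= _); last first.
    by rewrite ler_nat card_colors_between_subgraph.
  apply: le_trans (good _ rich) => /=; rewrite -/r in col *.
  have h1 : 0 <= r * p by rewrite mulr_ge0.
  have := ler_wpM2l h1 col; lra.
apply: le_trans (_ : (#|A|%:R - a%:R) * (r ^+ 3 * p * #|B|%:R) <= _).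
  have h1 : 0 <= r ^+ 3 * p * #|B|%:R by rewrite !mulr_ge0.
  have h2 : r * #|A|%:R <= #|A|%:R - a%:R by rewrite /r; lra.
  apply: le_trans (ler_wpM2r h1 h2).
  (* The difference of the two sides is [(eta * (eta - 2)) ^+ 2 + 2 * eta ^+ 2]. *)
  have h3 : 1 - 4 * eta <= r ^+ 4.
    rewrite /r; have := sqr_ge0 (eta * (eta - 2)); have := sqr_ge0 eta; lra.
  have h4 : 0 <= p * #|A|%:R * #|B|%:R by rewrite !mulr_ge0.
  have := ler_wpM2r h4 h3; lra.
apply: (peel (f := fun X => (edges_between H X B)%:R) a_gt0).
- by rewrite !mulr_ge0.
- by [].
- by move=> X Y dXY; rewrite -natrD ler_nat edges_betweenUl.
move=> X XA; rewrite ler_nat => X_ge.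
have [T /andP[TX /eqP cT]] : exists T : {set V}, (T \subset X) && (#|T| == a).
  have : [set T : {set V} | T \subset X & #|T| == a] != set0.
    by rewrite -cards_eq0 cards_draws -lt0n bin_gt0.
  by case/set0Pn => T; rewrite inE; exists T.
by exists T => //; split=> //; apply: slab.
Qed.

End RandomSubgraph.

(** * Choice of constants and passage to the limit *)

Local Open Scope classical_set_scope.

Theorem theorem6 (R : realType) :
  exists2 eps0 : R, 0 < eps0 &
  forall eps : R, 0 < eps -> eps < eps0 ->
  exists2 C : R, 0 < C &
  forall (K : nat -> finType) (G : forall n : nat, sgraph 'I_n)
    (c : forall n : nat, {set 'I_n} -> K n) (p delta : nat -> R),
  (forall n : nat, 0 < p n /\ p n <= 1) ->
  (forall n : nat, proper_coloring (G n) (c n)) ->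
  (forall n : nat, (1 - delta n) * n%:R <= (mindeg (G n))%:R) ->
  (fun n : nat => random_colors_prob (p n) (fun S : {set K n} =>
    let H := color_subgraph (G n) (c n) S in
    let L := log2 n%:R / p n in
    ((1 - delta n) * n%:R >= C * L ->
      forall v : 'I_n,
        (1 - eps) * p n * (deg (G n) v)%:R <= (deg H v)%:R /\
        (deg H v)%:R <= (1 + eps) * p n * (deg (G n) v)%:R) /\
    (forall A B : {set 'I_n}, [disjoint A & B]%B ->
      #|A|%:R >= C * L ->
      #|B|%:R >= Num.max (C * L ^+ 2) (C * delta n * n%:R) ->
      (edges_between H A B)%:R >= (1 - eps) * p n * #|A|%:R * #|B|%:R)))
    @ \oo --> (1 : R).
Proof.
exists 1 => // eps eps_gt0 eps_lt1.
(* [eta] is a quarter of [eps] because four factors [1 - eta] are lost. [M - 1] is the constant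
   required for rich pairs, and the extra 1 absorbs rounding in the block size. *)
pose eta : R := eps / 4; pose M : R := 48 / eta ^+ 2 + 1.
have eta_gt0 : 0 < eta by rewrite divr_gt0.
have eta_le : eta <= 1 / 4 by rewrite /eta; lra.
have eta2_gt0 : 0 < eta ^+ 2 by rewrite exprn_gt0.
have M_ge1 : 1 <= M by rewrite lerDr divr_ge0 ?ltW.
pose C : R := 4 * M ^+ 2 / eta ^+ 2.
have C_eta2 : C * eta ^+ 2 = 4 * M ^+ 2 by rewrite divfK ?gt_eqF.
have C_gt0 : 0 < C by rewrite divr_gt0 // mulr_gt0 // exprn_gt0; lra.
exists C => // K G c p delta p01 c_proper degG.
(* The failure probability will be at most [3 / n]; since [harmonic n] is [1 / (n + 1)], the factor
   6 covers the shift. *)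
apply: (squeeze_cvgr (f := fun n => 1 - 6 * harmonic n) (h := fun=> 1)); last 2 first.
- rewrite -[X in _ --> X]subr0 -[X in _ --> _ - X](mulr0 6).
  by apply: cvgB; [exact: cvg_cst | apply: cvgMr; exact: cvg_harmonic].
- exact: cvg_cst.
near=> n.
have n_gt1 : (1 < n)%N by near: n; exists 2%N.
have [p_gt0 p_le1] := p01 n; have p_ge0 := ltW p_gt0.
rewrite random_colors_prob_le1 // andbT.
have N_ge2 : 2 <= n%:R :> R by rewrite ler_nat.
apply: le_trans (_ : 1 - 3 / n%:R <= _).
  rewrite lerD2l lerN2 /harmonic /= -natr1 ler_pdivrMr; last by lra.
  rewrite mulrAC ler_pdivlMr; lra.
pose L := log2 (n%:R : R) / p n.
have ln2_gt0 : 0 < ln (2 : R) by rewrite ln_gt0 // ltr1n.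
have ln2_le1 : ln (2 : R) <= 1 by apply: (le_ln1Dx (x := 1)); lra.
have lnn_ge : ln 2 <= ln (n%:R : R) by rewrite ler_ln ?posrE; lra.
have pL : p n * L = log2 (n%:R : R) by rewrite mulrC divfK ?gt_eqF.
(* Passing from base 2 to natural logarithms only helps, as [ln 2 <= 1]. *)
have pL_ge : ln (n%:R : R) <= p n * L.
  by rewrite pL /log2 ler_pdivlMr //; nra.
have L_ge1 : 1 <= L.
  rewrite /L ler_pdivlMr // mul1r; apply: le_trans p_le1 _.
  by rewrite /log2 ler_pdivlMr // mul1r.
(* The block size lies between [(M - 1) * L] and [M * L]; the upper bound uses [1 <= L]. *)
pose a := (Num.trunc ((M - 1) * L)).+1.
have ML_ge0 : 0 <= (M - 1) * L by nra.
have /andP[a_le a_ge] := truncn_itv ML_ge0.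
have {a_le} a_le : a%:R <= M * L by rewrite /a -natr1; nra.
have pa_ge : 48 / eta ^+ 2 * ln n%:R <= p n * a%:R.
  have -> : 48 / eta ^+ 2 = M - 1 by rewrite addrK.
  apply: le_trans (_ : (M - 1) * (p n * L) <= _).
    by apply: ler_wpM2l => //; lra.
  by rewrite mulrCA; apply: ler_wpM2l => //; apply: ltW.
have N_eq : #|'I_n|%:R = n%:R :> R by rewrite card_ord.
pose X S := exists2 Y, color_rich (G n) (c n) eta a Y &
    #|S :&: colors_between (G n) (c n) Y.1 Y.2|%:R <=
      (1 - eta) * p n * #|colors_between (G n) (c n) Y.1 Y.2|%:R.
have X_prob : random_colors_prob (p n) X <= n%:R^-1.
  rewrite -N_eq; apply: color_rich_prob => //; rewrite ?N_eq //; lra.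
(* The degree condition is part of the event, so [D] is empty, with probability 0, when the
   condition fails. *)
pose D S := C * L <= (1 - delta n) * n%:R /\ exists2 v, v \in 'I_n &
  (deg (color_subgraph (G n) (c n) S) v)%:R <= (1 - eps) * p n * (deg (G n) v)%:R \/
  (1 + eps) * p n * (deg (G n) v)%:R <= (deg (color_subgraph (G n) (c n) S) v)%:R.
have degGn v : (1 - delta n) * n%:R <= (deg (G n) v)%:R.
  by apply: le_trans (degG n) _; rewrite ler_nat mindeg_le.
have D_prob : random_colors_prob (p n) D <= 2 / n%:R.
  have [CL|CL] := leP (C * L) ((1 - delta n) * n%:R); last first.
    rewrite /random_colors_prob big1 ?divr_ge0 // => S /asboolP[].
    by rewrite leNgt CL.
  apply: le_trans (_ : random_colors_prob (p n) (fun S => exists2 v, v \in 'I_n & _) <= _).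
    by apply: sub_random_colors_prob => // S [_ h]; exact: h.
  rewrite -N_eq; apply: (degree_deviation_prob (c_proper n)); rewrite ?N_eq //; try lra.
  move=> v; apply: le_trans (_ : C * (p n * L) <= _); last first.
    rewrite mulrCA; apply: ler_wpM2l => //; exact: le_trans CL (degGn v).
  apply: ler_pM => //; first by rewrite divr_ge0 ?sqr_ge0.
    lra.
  have -> : 16 / eps ^+ 2 = 1 / eta ^+ 2 by rewrite /eta; field; rewrite gt_eqF.
  rewrite ler_pdivrMr // C_eta2; nra.
rewrite random_colors_probC lerD2l lerN2.
apply: le_trans (_ : random_colors_prob (p n) (fun S => D S \/ X S) <= _); last first.
  apply: le_trans (random_colors_probU p_ge0 p_le1 _ _) _.
  apply: le_trans (lerD D_prob X_prob) _; lra.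
apply: sub_random_colors_prob => // S; apply: contra_notP => /not_orP[nD nX] /=.
rewrite -/L; split=> [CL v | A B _ A_ge].
  by split; apply: ltW; rewrite ltNge; apply/negP => h; apply: nD; split=> //;
    exists v => //; [left | right].
rewrite ge_max => /andP[B_ge1 B_ge2].
rewrite (_ : eps = 4 * eta); last by rewrite /eta; lra.
have a1 : 1 <= a%:R :> R by rewrite ler1n.
(* A vertex [x] yields [(1 - delta n) * n <= deg x <= n], hence a nonnegative degree deficit
   [delta n * n]. *)
have [x _] : exists x, x \in A.
  apply/set0Pn; rewrite -card_gt0 -(ltr0n R); nra.
have d_ge0 : 0 <= delta n * n%:R.
  have := degGn x; have : (deg (G n) x)%:R <= n%:R :> R.
    by rewrite ler_nat -[leqRHS](card_ord n) max_card.
  lra.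
have ML2 : a%:R ^+ 2 <= M ^+ 2 * L ^+ 2.
  by rewrite -exprMn lerXn2r ?nnegrE //; lra.
apply: (@edges_between_color_subgraph_ge _ _ _ _ _ (c_proper n) _ p_ge0 _ eta
  (delta n * n%:R) a) => //.
- lra.
- by move=> v; rewrite N_eq; have := degGn v; lra.
- move=> Y rich; apply: ltW; rewrite ltNge; apply/negP => h; apply: nX; exists Y => //.
- apply: le_trans a_le _; apply: le_trans (ler_wpM2l (ltW eta_gt0) A_ge).
  rewrite [leRHS]mulrA; apply: ler_wpM2r; first by lra.
  rewrite -(ler_pM2r eta_gt0) (_ : eta * C * eta = C * eta ^+ 2); last by ring.
  rewrite C_eta2; nra.
(* After clearing the denominator, each of [a * eta], [a ^+ 2] and [delta n * n] is at most a
   quarter of [eta ^+ 2 * #|B|], by [C * eta ^+ 2 = 4 * M ^+ 2] and the two lower bounds on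
   [#|B|]. *)
rewrite -(ler_pM2r eta_gt0) mulrDl divfK ?gt_eqF //.
have C_ge4 : 4 <= C * eta ^+ 2 by rewrite C_eta2; nra.
have B1 := ler_wpM2l (ltW eta2_gt0) B_ge1.
have B2 := ler_wpM2l (ltW eta2_gt0) B_ge2.
have d4 := ler_wpM2r d_ge0 C_ge4.
have aa : a%:R <= a%:R ^+ 2 :> R by nra.
have aeta : a%:R * eta <= a%:R ^+ 2 by nra.
have B1' : 4 * (M ^+ 2 * L ^+ 2) <= eta ^+ 2 * #|B|%:R.
  by apply: le_trans B1; rewrite mulrA -C_eta2 mulrAC mulrC.
have B2' : 4 * (delta n * n%:R) <= eta ^+ 2 * #|B|%:R.
  by apply: le_trans B2; rewrite -[C * _ * _]mulrA [leRHS]mulrA [_ * C]mulrC.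
lra.
Unshelve. all: by end_near.
Qed.
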